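(* For all natural numbers $n\ge 2$ and $k \ge 1$: $\bar {\mathfrak v}_n^{\mathrm{const}} (k) = {\mathfrak v}_n^{\mathrm{const}} (k) = {\mathfrak v}_2^{\mathrm{const}} (k)$ and $\bar {\mathfrak e}_n^{\mathrm{const}} (k) = {\mathfrak e}_n^{\mathrm{const}} (k) = {\mathfrak e}_2^{\mathrm{const}} (k)$.
   Context: Identify $n$ with $\{0,\dots,n-1\}$. A predictor is a function $\pi : n^{<\omega} \to n$. A predictor $\pi$ $k$--constantly predicts $x \in n^\omega$ if for all but finitely many intervals $I=\{a,\dots,a+k-1\}$ of length $k$ there is $i \in I$ with $x(i) = \pi(x{\upharpoonright} i)$. It weakly $k$--constantly predicts $x$ if for all but finitely many $m$ there is $i<k$ with $\pi(x{\upharpoonright} mk+i) = x(mk+i)$. ${\mathfrak v}_n^{\mathrm{const}}(k)$ is the least size of a set $\Pi$ of predictors $n^{<\omega}\to n$ such that every $x\in n^\omega$ is $k$--constantly predicted by some $\pi\in\Pi$; $\bar{\mathfrak v}_n^{\mathrm{const}}(k)$ is defined the same way with weak $k$--constant prediction. ${\mathfrak e}_n^{\mathrm{const}}(k)$ is the least size of a set $F\subseteq n^\omega$ such that for every predictor $\pi:n^{<\omega}\to n$ some $x\in F$ is not $k$--constantly predicted by $\pi$; $\bar{\mathfrak e}_n^{\mathrm{const}}(k)$ is the least size of $F\subseteq n^\omega$ such that no predictor weakly $k$--constantly predicts all members of $F$. *)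

(* Defs.v *)
From mathcomp Require Import all_boot.
From mathcomp Require Import all_classical.

Set Implicit Arguments.
Unset Strict Implicit.
Unset Printing Implicit Defensive.

Local Open Scope classical_set_scope.
Local Open Scope card_scope.

(* MathComp-Analysis has no type of cardinals, only the relations #<= and #=
   between sets.  A cardinal defined as a least size is therefore represented by
   a set of that size: an arbitrary member of C of least cardinality.  The
   default [set0] is never used when C is nonempty, see [least_sizeP]. *)
Definition least_size (T : Type) (C : set (set T)) : set T :=
  xget set0 [set A | C A /\ forall B, C B -> A #<= B].

Lemma least_sizeP (T : Type) (C : set (set T)) : C !=set0 ->
  C (least_size C) /\ forall B, C B -> least_size C #<= B.
Proof.
move=> [A0 CA0]; apply: (@xgetPex (set T) set0 [set A | C A /\ _]).
(* M ranges over the sets of choice functions on C that are injective in each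
   coordinate; a maximal M projects onto some member of C. *)
pose P (M : set (set T -> T)) :=
  (forall f A, M f -> C A -> A (f A)) /\
  (forall f g A, M f -> M g -> C A -> f A = g A -> f = g).
have [|M [[MC Minj] Mmax]] := @Zorn_bigcup (set T -> T) P.
  move=> F FP Ftot; split=> [f A [M FM Mf] CA|f g A [M FM Mf] [N FN Ng]].
    exact: (FP _ FM).1 _ _ Mf CA.
  have [MN|NM] := Ftot _ _ FM FN.
    exact: (FP _ FN).2 _ _ A (MN _ Mf) Ng.
  exact: (FP _ FM).2 _ _ A Mf (NM _ Ng).
have Mcard A : C A -> (fun f : set T -> T => f A) @` M #= M.
  move=> CA; apply: inj_card_eq => f g; rewrite !inE => Mf Mg.
  exact: Minj.
suff [A [CA Asurj]] : exists A, C A /\ A `<=` (fun f : set T -> T => f A) @` M.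
  exists A; split=> // B CB.
  apply: card_le_trans (subset_card_le Asurj) _.
  rewrite (card_le_eql (Mcard _ CA)) -(card_le_eql (Mcard _ CB)).
  by apply: subset_card_le => _ [f Mf <-]; exact: MC CB.
apply: contrapT => noA.
have pick A : C A -> exists2 a, A a & forall f, M f -> f A <> a.
  move=> CA; apply: contrapT => noa; apply: noA; exists A; split=> // a Aa.
  apply: contrapT => nof; apply: noa; exists a => // f Mf fAa.
  by apply: nof; exists f.
have [a0 _ _] := pick _ CA0.
have /choice[g gP] : forall A, exists a,
    C A -> A a /\ forall f, M f -> f A <> a.
  move=> A; have [CA|nCA] := pselect (C A); last by exists a0.
  by have [a Aa aM] := pick _ CA; exists a.
apply: (Mmax (M `|` [set g])).
  split; first by move=> f Mf; left.
  by move=> /(_ g (or_intror erefl)) Mg; apply: (gP _ CA0).2 Mg _.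
split=> [f A [Mf|->] CA|f h A [Mf|->] [Mh|->] CA e //].
- exact: MC CA.
- exact: (gP _ CA).1.
- exact: Minj Mf Mh CA e.
- by case: ((gP _ CA).2 _ Mf).
- by case: ((gP _ CA).2 _ Mh).
Qed.

Definition predictor (n : nat) := seq 'I_n -> 'I_n.

(* [mkseq x i] is the restriction of x to i = {0, ..., i-1}. *)
Definition predicts_at (n : nat) (pi : predictor n) (x : nat -> 'I_n)
  (i : nat) : Prop := x i = pi (mkseq x i).

Definition const_predicts (n k : nat) (pi : predictor n) (x : nat -> 'I_n) :
    Prop :=
  cofinite_set [set a | exists i, a <= i < a + k /\ predicts_at pi x i].

Definition weakly_const_predicts (n k : nat) (pi : predictor n)
    (x : nat -> 'I_n) : Prop :=
  cofinite_set [set m | exists i, i < k /\ predicts_at pi x (m * k + i)].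

Definition v_const (n k : nat) : set (predictor n) :=
  least_size [set Pi | forall x, exists pi, Pi pi /\ const_predicts k pi x].

Definition vbar_const (n k : nat) : set (predictor n) :=
  least_size
    [set Pi | forall x, exists pi, Pi pi /\ weakly_const_predicts k pi x].

Definition e_const (n k : nat) : set (nat -> 'I_n) :=
  least_size [set F | forall pi, exists x, F x /\ ~ const_predicts k pi x].

Definition ebar_const (n k : nat) : set (nat -> 'I_n) :=
  least_size
    [set F | ~ exists pi, forall x, F x -> weakly_const_predicts k pi x].

Arguments v_const : clear implicits.
Arguments vbar_const : clear implicits.
Arguments e_const : clear implicits.
Arguments ebar_const : clear implicits.

(* For n >= 2 and k >= 1 the four families above are nonempty, so that the
   default value of [least_size] is not reached. *)
Lemma all_predicted (n : nat) (x : nat -> 'I_n) :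
  exists pi : predictor n, forall i, predicts_at pi x i.
Proof.
by exists (fun s => x (size s)) => i; rewrite /predicts_at size_mkseq.
Qed.

Lemma evaded (n : nat) (pi : predictor n) : 1 < n ->
  exists x : nat -> 'I_n, forall i, ~ predicts_at pi x i.
Proof.
case: n pi => [//|[//|n]] pi _.
pose other (a : 'I_n.+2) : 'I_n.+2 := if a == ord0 then ord_max else ord0.
have otherP a : other a != a.
  by rewrite /other; case: (eqVneq a ord0) => [->|]; rewrite // eq_sym.
pose s := fix s i := if i is j.+1 then rcons (s j) (other (pi (s j))) else [::].
pose x i := other (pi (s i)).
have sE i : s i = mkseq x i.
  elim: i => [//|i IH]; rewrite mkseqS -IH /=; congr rcons.
by exists x => i; rewrite /predicts_at -sE; apply/eqP/otherP.
Qed.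

Lemma v_family_neq0 (n k : nat) : 0 < k ->
  [set Pi : set (predictor n) |
    forall x, exists pi, Pi pi /\ const_predicts k pi x] !=set0.
Proof.
move=> k0; exists setT => x; have [pi pix] := all_predicted x.
exists pi; split=> //; rewrite /const_predicts (_ : [set _ | _] = setT).
  by rewrite setCT; apply: finite_set0.
by apply/seteqP; split=> // a _; exists a; rewrite leqnn -addn1 leq_add2l k0.
Qed.

Lemma vbar_family_neq0 (n k : nat) : 0 < k ->
  [set Pi : set (predictor n) |
    forall x, exists pi, Pi pi /\ weakly_const_predicts k pi x] !=set0.
Proof.
move=> k0; exists setT => x; have [pi pix] := all_predicted x.
exists pi; split=> //; rewrite /weakly_const_predicts (_ : [set _ | _] = setT).
  by rewrite setCT; apply: finite_set0.
by apply/seteqP; split=> // m _; exists 0.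
Qed.

Lemma e_family_neq0 (n k : nat) : 1 < n ->
  [set F : set (nat -> 'I_n) |
    forall pi, exists x, F x /\ ~ const_predicts k pi x] !=set0.
Proof.
move=> n1; exists setT => pi; have [x xpi] := evaded pi n1.
exists x; split=> //; rewrite /const_predicts (_ : [set _ | _] = set0).
  by rewrite setC0; apply: infinite_nat.
by apply/seteqP; split=> // a [i [_ /xpi]].
Qed.

Lemma ebar_family_neq0 (n k : nat) : 1 < n ->
  [set F : set (nat -> 'I_n) |
    ~ exists pi, forall x, F x -> weakly_const_predicts k pi x] !=set0.
Proof.
move=> n1; exists setT => -[pi piT]; have [x xpi] := evaded pi n1.
have := piT x I; rewrite /weakly_const_predicts (_ : [set _ | _] = set0).
  by rewrite setC0; apply: infinite_nat.
by apply/seteqP; split=> // m [i [_ /xpi]].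
Qed.

(* Main.v *)
(* A weak k-predictor for binary sequences amounts to a rule that excludes, in
   each block of length k, one of the 2^k possible continuations.  Let x be a
   sequence over n letters, and suppose that its next block is known to lie in a
   set of at least 2^k candidates; mapping that set onto the 2^k binary blocks
   turns x into a binary sequence, a weak k-predictor of which excludes at least
   one candidate.  After finitely many rounds fewer than 2^k candidates remain,
   and guessing the majority value letter by letter then halves them with each
   wrong guess, so some guess in the block is right.  Doing this for the k shifts
   of x and always following the predictor whose blocks start right after the
   last correct guess yields k-constant prediction.

   So x is predicted from finitely many binary predictors, each applied to a
   sequence that depends on the previous ones.  For the evasion numbers one
   predictor at a time handles a whole small family; for the prediction numbers
   one uses that the square of an infinite set has the size of that set. *)

Require Import Defs.
From mathcomp Require Import all_boot.
From mathcomp Require Import all_classical.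

Set Implicit Arguments.
Unset Strict Implicit.
Unset Printing Implicit Defensive.

Local Open Scope classical_set_scope.
Local Open Scope card_scope.

(** * Squares of infinite sets *)

Lemma card_le_surjP (T U : Type) (A : set T) (B : set U) : inhabited T ->
  A #<= B <-> exists g : U -> T, A `<=` g @` B.
Proof.
move=> [t]; split=> [|[g Ag]]; last first.
  exact: card_le_trans (subset_card_le Ag) (card_image_le _ _).
move/pfcard_geP => [->|/surjfunPex[g ->]]; last by exists g.
by exists (fun=> t).
Qed.

Lemma card_le_injP (T U : Type) (A : set T) (B : set U) : inhabited U ->
  A #<= B <-> exists2 f : T -> U, set_fun A B f & set_inj A f.
Proof.
move=> [u]; split=> [AB|[f fAB finj]]; last first.
  rewrite -(card_le_eql (inj_card_eq finj)); apply: subset_card_le.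
  by move=> _ [a Aa <-]; apply: fAB.
have [t|nT] := pselect (inhabited T); last first.
  by exists (fun=> u) => a; case: nT.
have /card_le_surjP[//|g gB] := AB.
have /choice[f fP] : forall a, exists b, A a -> B b /\ g b = a.
  move=> a; have [Aa|nAa] := pselect (A a); last by exists u.
  by have [b Bb e] := gB _ Aa; exists b.
exists f => [a /fP[]//|a a']; rewrite !inE => /fP[_ {2}<-] /fP[_ {2}<-].
by move=> ->.
Qed.

Lemma card_le_bigcup (I T U : Type) (D : set I) (F : I -> set T) (B : set U) :
  (forall i, D i -> F i #<= B) -> \bigcup_(i in D) F i #<= D `*` B.
Proof.
move=> FB; have [->|/set0P[t _]] := eqVneq (\bigcup_(i in D) F i) set0.
  exact: card_ge0.
have /choice[g gP] : forall i, exists g : U -> T, D i -> F i `<=` g @` B.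
  move=> i; have [Di|nDi] := pselect (D i); last by exists (fun=> t).
  by have /card_le_surjP[//|g Fg] := FB _ Di; exists g.
apply/card_le_surjP => //; exists (fun p => g p.1 p.2) => x [i Di Fix].
by have [u Bu <-] := gP _ Di _ Fix; exists (i, u).
Qed.

Lemma card_leX (T U T' U' : Type) (A : set T) (B : set U) (A' : set T')
    (B' : set U') : A #<= A' -> B #<= B' -> A `*` B #<= A' `*` B'.
Proof.
move=> AA BB; have [->|/set0P[[a b] [/= Aa Bb]]] := eqVneq (A `*` B) set0.
  exact: card_ge0.
have /card_le_surjP[//|f fA] := AA; have /card_le_surjP[//|g gB] := BB.
apply/card_le_surjP => //; exists (fun p => (f p.1, g p.2)).
move=> [x y] [/= Ax By].
have [x' Ax' <-] := fA _ Ax; have [y' By' <-] := gB _ By.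
by exists (x', y').
Qed.

(** Comparability is the existence of a member of least size in the family consisting of [A] and
    [B]. *)
Lemma card_le_total (T : Type) (A B : set T) : A #<= B \/ B #<= A.
Proof.
have [|] := @least_sizeP T [set A; B]; first by exists A; left.
by move=> [->|->] le; [left; apply: le; right|right; apply: le; left].
Qed.

Lemma card_leU (T U : Type) (A B : set T) (D : set U) p q : D p -> D q ->
  p <> q -> A #<= D -> B #<= D -> A `|` B #<= D `*` D.
Proof.
move=> Dp Dq pq AD BD; pose F i := if pselect (i = p) then A else B.
have FD i : D i -> F i #<= D by rewrite /F; case: pselect.
apply: card_le_trans (card_le_bigcup FD).
apply: subset_card_le => x [Ax|Bx].
  by exists p => //; rewrite /F; case: pselect.
by exists q => //; rewrite /F; case: pselect => // e; case: pq.
Qed.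

(* A triple (a, b, c) in M says that the pair (a, b) is coded by c. *)
Definition pairing_field (T : Type) (M : set (T * T * T)) : set T :=
  [set a | exists c, M (a, a, c)].

(** A relation instead of a function, so that unions of chains are again pairings. A code determines
    its pair; choosing a code for each pair yields the injection of [pairing_card]. *)
Definition pairing (T : Type) (A : set T) (M : set (T * T * T)) : Prop :=
  [/\ pairing_field M `<=` A,
      forall a b c, M (a, b, c) ->
        [/\ pairing_field M a, pairing_field M b & pairing_field M c],
      forall a b, pairing_field M a -> pairing_field M b ->
        exists c, M (a, b, c) &
      forall a b c a' b', M (a, b, c) -> M (a', b', c) -> a = a' /\ b = b'].

Lemma pairing_card (T : Type) (A : set T) (M : set (T * T * T)) :
  pairing A M -> pairing_field M `*` pairing_field M #<= pairing_field M.
Proof.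
move=> [_ fld tot inj]; set D := pairing_field M.
have [->|/set0P[[p q] [/= Dp _]]] := eqVneq (D `*` D) set0.
  exact: card_ge0.
have /choice[f fP] : forall u : T * T, exists c, (D `*` D) u -> M (u, c).
  move=> [a b]; have [[/= Da Db]|nD] := pselect ((D `*` D) (a, b)).
    by have [c Mc] := tot _ _ Da Db; exists c.
  by exists p.
apply/card_le_injP => //; exists f.
  by move=> [a b] Dab; have [] := fld _ _ _ (fP _ Dab).
move=> [a b] [a' b']; rewrite !inE => Dab Dab' e.
have Ma := fP _ Dab; have := fP _ Dab'; rewrite -e => Mb.
by have [-> ->] := inj _ _ _ _ _ Ma Mb.
Qed.

Lemma countable_pairing (T : Type) (A : set T) : infinite_set A ->
  exists M, pairing A M /\ infinite_set (pairing_field M).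
Proof.
move=> infA; have [t _] := infinite_setN0 infA.
have /infiniteP/card_le_injP[//|f fA finj'] := infA.
have finj i j : f i = f j -> i = j by apply: finj'; rewrite inE.
pose M := [set u | exists i j, u = (f i, f j, f (pickle (i, j)))].
have fldE : pairing_field M = range f.
  apply/seteqP; split=> [a [c [i [j [-> _ _]]]]|_ [i _ <-]]; first by exists i.
  by exists (f (pickle (i, i))), i, i.
exists M; split; last first.
  rewrite fldE => fin; apply: infinite_nat; apply: card_le_finite fin.
  by apply/card_le_injP => //; exists f => //= i _; exists i.
split; rewrite ?fldE.
- by move=> _ [i _ <-]; apply: fA.
- by move=> a b c [i [j [-> -> ->]]]; split; eexists.
- by move=> _ _ [i _ <-] [j _ <-]; exists (f (pickle (i, j))), i, j.
move=> a b c a' b' [i [j [-> -> ->]]] [i' [j' [-> -> /finj e]]].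
by have [-> ->] := pcan_inj pickleK e.
Qed.

(** The room outside the field [D] holds a copy [E] of [D]. The square of the union of [D] and [E]
    still injects into [E], so every new pair gets a code in [E], which cannot clash with the old
    codes in [D]. *)
Lemma pairing_extend (T : Type) (A : set T) (M : set (T * T * T)) :
  pairing A M -> infinite_set (pairing_field M) ->
  pairing_field M #<= A `\` pairing_field M ->
  exists N, pairing A N /\ M `<` N.
Proof.
move=> PM; have DD := pairing_card PM; have [MA fld tot inj] := PM.
set D := pairing_field M in DD MA fld tot * => infD DA.
have [p Dp] := infinite_setN0 infD.
have [q [Dq /= qp]] := infinite_setN0 (infinite_setD infD (finite_set1 p)).
have /card_le_injP[//|e eA einj] := DA.
pose E := e @` D.
have ED : E #<= D by exact: card_image_le.
have UD : D `|` E #<= D.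
  by apply: card_le_trans DD; apply: (card_leU Dp Dq) => // pq; exact: qp.
have /card_le_injP[//|h hE hinj] : (D `|` E) `*` (D `|` E) #<= E.
  apply: card_le_trans (card_leX UD UD) _; apply: card_le_trans DD _.
  by rewrite (card_le_eqr (inj_card_eq einj)).
have {}hinj a b a' b' : (D `|` E) a -> (D `|` E) b -> (D `|` E) a' ->
    (D `|` E) b' -> h (a, b) = h (a', b') -> a = a' /\ b = b'.
  move=> Ua Ub Ua' Ub' eh; have := hinj (a, b) (a', b'); rewrite !inE.
  by move=> /(_ (conj Ua Ub) (conj Ua' Ub') eh) [-> ->].
pose N := M `|` [set u | [/\ (D `|` E) u.1.1, (D `|` E) u.1.2,
  ~ (D u.1.1 /\ D u.1.2) & u.2 = h u.1]].
have EnD a : E a -> ~ D a by move=> [b Db <-]; have [] := eA _ Db.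
have fldE : pairing_field N = D `|` E.
  apply/seteqP; split=> a.
    by move=> [c [Mc|[]]] //; left; have [] := fld _ _ _ Mc.
  move=> [Da|Ea]; first by have [c Mc] := tot _ _ Da Da; exists c; left.
  by exists (h (a, a)); right; split=> //=; [right..|case=> /(EnD _ Ea)].
have hN a b : (D `|` E) a -> (D `|` E) b -> exists c, N (a, b, c).
  move=> Ua Ub; have [[Da Db]|nab] := pselect (D a /\ D b).
    by have [c Mc] := tot _ _ Da Db; exists c; left.
  by exists (h (a, b)); right.
exists N; split; last first.
  split; first by move=> u; left.
  move=> NM; have Ee : E (e p) by exists p.
  have [||c /NM Mc] := hN (e p) (e p); [by right..|].
  by have [/(EnD _ Ee)] := fld _ _ _ Mc.
split; rewrite ?fldE //.
- by move=> a [/MA//|[b Db <-]]; have [] := eA _ Db.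
- move=> a b c [Mc|[/= Ua Ub _ ->]].
    by have [Da Db Dc] := fld _ _ _ Mc; split; left.
  by split=> //; right; apply: hE.
move=> a b c a' b' [Mc|[/= Ua Ub _ ec]] [Mc'|[/= Ua' Ub' _ ec']].
- exact: inj Mc Mc'.
- have [_ _ Dc] := fld _ _ _ Mc; case: (EnD c) => //.
  by rewrite ec'; apply: hE.
- have [_ _ Dc] := fld _ _ _ Mc'; case: (EnD c) => //.
  by rewrite ec; apply: hE.
- by apply: hinj => //; rewrite -ec -ec'.
Qed.

Lemma infinite_card_square (T : Type) (A : set T) :
  infinite_set A -> A `*` A #<= A.
Proof.
move=> infA; have [M0 [PM0 inf0]] := countable_pairing infA.
(* The guard [M !=set0] makes [P] hold for the union of the empty chain; containing [M0] keeps the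
   field infinite. *)
pose P M := M !=set0 -> pairing A M /\ M0 `<=` M.
have [F FP Ftot|M [PM Mmax]] := @Zorn_bigcup (T * T * T) P.
  move=> [u [M1 FM1 M1u]].
  have FP' M v : F M -> M v -> pairing A M /\ M0 `<=` M.
    by move=> FM Mv; apply: FP => //; exists v.
  have fldS (M N : set (T * T * T)) :
      M `<=` N -> pairing_field M `<=` pairing_field N.
    by move=> MN a [c /MN]; exists c.
  have common M N v w : F M -> F N -> M v -> N w -> exists O,
      [/\ F O, M `<=` O, N `<=` O & pairing A O].
    move=> FM FN Mv Nw; have [MN|NM] := Ftot _ _ FM FN.
      by exists N; split=> //; have [] := FP' _ _ FN Nw.
    by exists M; split=> //; have [] := FP' _ _ FM Mv.
  have FU M : F M -> M `<=` \bigcup_(X in F) X by move=> FM v Mv; exists M.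
  split; last first.
    by move=> v M0v; exists M1 => //; apply: (FP' _ _ FM1 M1u).2.
  split.
  - move=> a [c [M FM Mc]]; have [[MA _ _ _] _] := FP' _ _ FM Mc.
    by apply: MA; exists c.
  - move=> a b c [M FM Mc]; have [[_ fld _ _] _] := FP' _ _ FM Mc.
    by have [? ? ?] := fld _ _ _ Mc; split; apply: (fldS _ _ (FU _ FM)).
  - move=> a b [c [M FM Mc]] [c' [N FN Nc']].
    have [O [FO MO NO [_ _ tot _]]] := common _ _ _ _ FM FN Mc Nc'.
    have [||d Od] := tot a b; [by exists c; apply: MO|by exists c'; apply: NO|].
    by exists d, O.
  - move=> a b c a' b' [M FM Mc] [N FN Nc'].
    have [O [FO MO NO [_ _ _ inj]]] := common _ _ _ _ FM FN Mc Nc'.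
    exact: inj (MO _ Mc) (NO _ Nc').
have [p [c0 M0p]] := infinite_setN0 inf0.
have [M00|/set0P Mn0] := eqVneq M set0.
  case: (Mmax M0); last by move=> _; split.
  by rewrite M00; split=> [//|/(_ _ M0p)].
have [PAM M0M] := PM Mn0; set D := pairing_field M.
have infD : infinite_set D.
  by apply: sub_infinite_set inf0 => a [c /M0M]; exists c.
have DD : D `*` D #<= D := pairing_card PAM.
have [Dp Ap] : D p /\ A p.
  have Dp : D p by exists c0; apply: M0M.
  by split=> //; case: PAM => MA _ _ _; apply: MA.
have [q [Dq /= qp]] := infinite_setN0 (infinite_setD infD (finite_set1 p)).
have [AD|DA] := card_le_total (A `\` D) D; last first.
  have [N [PN MN]] := pairing_extend PAM infD DA.
  by case: (Mmax N MN) => _; split=> //; apply: subset_trans M0M MN.1.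
(* [A] is covered by [D] and its complement in [A], each of size at most [D], so [A] is bounded by
   the square of [D]. *)
have {}AD : A #<= D.
  apply: card_le_trans DD; apply: card_le_trans _ (card_leU Dp Dq _ _ AD) => //.
  - apply: subset_card_le => a Aa.
    by have [Da|nDa] := pselect (D a); [left; exact: Da|right].
  - by move=> pq; exact: qp.
apply: card_le_trans (card_leX AD AD) _; apply: card_le_trans DD _.
by apply: subset_card_le; case: PAM.
Qed.

(** * Reduction to binary sequences by adaptive queries *)

(* A solution is a tree of adaptive queries "which q weakly k-predicts f x?"
   whose leaves carry a p with R x p for all x in D that are still compatible
   with the answers. *)
Inductive solvable (k : nat) (X P : Type) (R : X -> P -> Prop) :
    set X -> Prop :=
| solvable_done D p : (forall x, D x -> R x p) -> solvable k R D
| solvable_ask D (f : X -> nat -> 'I_2) :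
    (forall q, solvable k R
                 (D `&` [set x | weakly_const_predicts k q (f x)])) ->
    solvable k R D.

Lemma solvable_sub (k : nat) (X P : Type) (R : X -> P -> Prop) (D E : set X) :
  E `<=` D -> solvable k R D -> solvable k R E.
Proof.
move=> + s; elim: s E => {D} [D p DR|D f _ IH] E ED.
  by apply: (@solvable_done _ _ _ _ _ p) => x /ED /DR.
by apply: (@solvable_ask _ _ _ _ _ f) => q; apply: (IH q); apply: setSI.
Qed.

(** A tree for [S] is grafted onto each leaf of the tree for [R]. *)
Lemma solvable_bind (k : nat) (X P Q : Type) (R : X -> P -> Prop)
    (S : X -> Q -> Prop) (D : set X) : solvable k R D ->
  (forall p, solvable k S (D `&` [set x | R x p])) -> solvable k S D.
Proof.
elim=> {D} [D p DR|D f _ IH] Sp.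
  by apply: solvable_sub (Sp p) => x Dx; split=> //; apply: DR.
apply: (@solvable_ask _ _ _ _ _ f) => q; apply: IH => p.
by apply: solvable_sub (Sp p) => x [[Dx _] Rx].
Qed.

Lemma solvable_ext (k : nat) (X P Q : Type) (R : X -> P -> Prop)
    (S : X -> Q -> Prop) (D : set X) (g : P -> Q) :
  (forall x p, D x -> R x p -> S x (g p)) -> solvable k R D -> solvable k S D.
Proof.
move=> RS s; apply: solvable_bind s _ => p.
by apply: (@solvable_done _ _ _ _ _ (g p)) => x [Dx]; apply: RS.
Qed.

(** Only answers from [Pi] need to be followed. At each node the leaves below are a union, indexed
    by [Pi], of sets no larger than [Pi], which the square of [Pi] bounds. *)
Lemma solvable_cover (k : nat) (X P : Type) (R : X -> P -> Prop) (D : set X)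
    (Pi : set (predictor 2)) : infinite_set Pi ->
  (forall y, exists pi, Pi pi /\ weakly_const_predicts k pi y) ->
  solvable k R D ->
  exists2 C : set P, C #<= Pi & forall x, D x -> exists2 p, C p & R x p.
Proof.
move=> infPi Piall; elim=> {D} [D p DR|D f _ IH].
  exists [set p]; last by move=> x /DR Rx; exists p.
  have [q Pq] := infinite_setN0 infPi.
  by apply/card_le_surjP => //; exists (fun=> p) => _ ->; exists q.
have /choice[C CP] : forall q, exists C : set P, C #<= Pi /\ forall x,
    D x -> weakly_const_predicts k q (f x) -> exists2 p, C p & R x p.
  by move=> q; have [C Cle CR] := IH q; exists C; split=> // x Dx Wx; apply: CR.
exists (\bigcup_(q in Pi) C q).
  apply: card_le_trans (infinite_card_square infPi).
  by apply: card_le_bigcup => q _; have [] := CP q.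
move=> x Dx; have [q [Pq Wq]] := Piall (f x).
by have [p Cp Rx] := (CP q).2 _ Dx Wq; exists p => //; exists q.
Qed.

(** Each query sends [F] to a family of binary sequences no larger than [F], so one answer serves
    all of [F] and a single branch is followed to its leaf. *)
Lemma solvable_uniform (k : nat) (X P : Type) (R : X -> P -> Prop)
    (D F : set X) :
  (forall G : set (nat -> 'I_2), G #<= F ->
    exists q, forall y, G y -> weakly_const_predicts k q y) ->
  F `<=` D -> solvable k R D -> exists p, forall x, F x -> R x p.
Proof.
move=> uni + s; elim: s => {D} [D p DR|D f _ IH] FD.
  by exists p => x /FD /DR.
have [q qF] := uni (f @` F) (card_image_le _ _).
apply: (IH q) => x Fx; split; first exact: FD.
by apply: qF; exists x.
Qed.

(** * Weak prediction *)

Lemma cofinite_natP (A : set nat) :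
  cofinite_set A <-> exists N, forall m, N <= m -> A m.
Proof.
split=> [/finite_seqP[s sE]|[N NA]]; last first.
  apply: sub_finite_set (finite_II N) => m /= nAm.
  by rewrite ltnNge; apply/negP => /NA.
exists (\max_(i <- s) i).+1 => m lem; apply: contrapT => nAm.
have ms : m \in s by have : (~` A) m by []; rewrite sE.
by move: lem; rewrite ltnNge leq_bigmax_seq.
Qed.

Lemma weakly_const_predictsP (n k : nat) (pi : predictor n) (x : nat -> 'I_n) :
  weakly_const_predicts k pi x <->
  exists N, forall m, N <= m -> exists i, i < k /\ predicts_at pi x (m * k + i).
Proof. exact: cofinite_natP. Qed.

Lemma const_predictsP (n k : nat) (pi : predictor n) (x : nat -> 'I_n) :
  const_predicts k pi x <-> exists N, forall a, N <= a ->
    exists i, a <= i < a + k /\ predicts_at pi x i.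
Proof. exact: cofinite_natP. Qed.

Lemma const_predicts_weakly (n k : nat) (pi : predictor n) (x : nat -> 'I_n) :
  0 < k -> const_predicts k pi x -> weakly_const_predicts k pi x.
Proof.
move=> k0 /const_predictsP[N pix]; apply/weakly_const_predictsP.
exists N => m Nm; have [|i [/andP[mi ik] pi_i]] := pix (m * k).
  by rewrite (leq_trans Nm) // leq_pmulr.
by exists (i - m * k); rewrite subnKC // ltn_subLR.
Qed.

Lemma finite_not_weakly_predicting (n k : nat) (Pi : set (predictor n)) :
  1 < n -> finite_set Pi ->
  exists x, forall pi, Pi pi -> ~ weakly_const_predicts k pi x.
Proof.
move=> n1 finPi.
have [->|/set0P[pi0 _]] := eqVneq Pi set0.
  by case: n n1 {Pi finPi} => // n _; exists (fun=> ord0).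
have [r /card_le_surjP[//|g gP]] : exists r, Pi #<= `I_r.
  by apply/finite_set_leP.
(* Block [m] consults predictor number [m] mod [r]; evading this mixture makes each of the [r]
   predictors miss a whole block infinitely often. *)
have [x xP] := evaded (fun s => g ((size s %/ k) %% r) s) n1.
exists x => pi /gP[j /= jr <-] /weakly_const_predictsP[N NP].
have r0 : 0 < r by apply: leq_ltn_trans jr.
have [|i [ik]] := NP (N * r + j).
  by rewrite (leq_trans (leq_pmulr _ r0)) ?leq_addr.
have := xP ((N * r + j) * k + i); rewrite /predicts_at size_mkseq.
by rewrite divnMDl ?(leq_ltn_trans _ ik) // divn_small // addn0
  modnMDl modn_small.
Qed.

(** * Cutting down the candidates for the next block *)

Lemma eq_mkseq (T : Type) (x y : nat -> T) (l : nat) :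
  (forall i, i < l -> x i = y i) -> mkseq x l = mkseq y l.
Proof.
by elim: l => // l IH xy; rewrite !mkseqS xy // IH // => i /ltnW; apply: xy.
Qed.

Lemma mkseqD (T : Type) (x : nat -> T) (a b : nat) :
  mkseq x (a + b) = mkseq x a ++ mkseq (fun i => x (a + i)) b.
Proof.
elim: b => [|b IH]; first by rewrite addn0 cats0.
by rewrite addnS !mkseqS IH rcons_cat.
Qed.

Definition block (n k : nat) (x : nat -> 'I_n) (m : nat) : k.-tuple 'I_n :=
  [tuple x (m * k + i) | i < k].

Lemma eq_block (n k m : nat) (x y : nat -> 'I_n) :
  (forall i, i < m.+1 * k -> x i = y i) -> block k x m = block k y m.
Proof.
move=> xy; apply: eq_from_tnth => i; rewrite !tnth_mktuple; apply: xy.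
by rewrite mulSn addnC ltn_add2r.
Qed.

(* A weak k-predictor pi rules out one of the 2^k possible next blocks: the one
   in which every guess of pi is wrong. *)
Lemma excluded_block (n k : nat) (pi : predictor n) (s : seq 'I_n) : 1 < n ->
  exists b, forall y m, mkseq y (m * k) = s -> block k y m = b ->
    forall i, i < k -> ~ predicts_at pi y (m * k + i).
Proof.
move=> n1; have [x xP] := evaded (fun t => pi (s ++ t)) n1.
exists [tuple x i | i < k] => y m ys yb i ik.
have yx j : j < k -> y (m * k + j) = x j.
  move=> jk; have := congr1 (fun t => tnth t (Ordinal jk)) yb.
  by rewrite !tnth_mktuple.
rewrite /predicts_at mkseqD ys yx // (@eq_mkseq _ _ x) => [|j ji].
  exact: xP.
by apply: yx; apply: ltn_trans ik.
Qed.

Lemma surjections (T U : finType) (u0 : U) : exists g : {set T} -> T -> U,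
  forall A : {set T}, #|U| <= #|A| -> forall u, exists2 t, t \in A & g A t = u.
Proof.
exists (fun (A : {set T}) t => nth u0 (enum U) (index t (enum A))) => A UA u.
have uA : index u (enum U) < size (enum A).
  by rewrite -cardE; apply: leq_trans UA; rewrite cardE index_mem mem_enum.
have [t0 _] : exists t, t \in A.
  by apply/set0Pn; rewrite -card_gt0 cardE; apply: leq_trans uA.
exists (nth t0 (enum A) (index u (enum U))).
  by rewrite -mem_enum mem_nth.
by rewrite index_uniq ?enum_uniq // nth_index // mem_enum.
Qed.

(** [S] is an adaptive slalom of width [L]: its set of blocks may depend on the history. *)
Definition localizes (n k L : nat) (x : nat -> 'I_n)
    (S : seq 'I_n -> {set k.-tuple 'I_n}) : Prop :=
  (forall s, #|S s| <= L) /\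
  exists N, forall m, N <= m -> block k x m \in S (mkseq x (m * k)).

Definition recode (n k : nat) (g : seq 'I_n -> k.-tuple 'I_n -> k.-tuple 'I_2)
    (x : nat -> 'I_n) (i : nat) : 'I_2 :=
  nth ord0 (g (mkseq x (i %/ k * k)) (block k x (i %/ k))) (i %% k).

Lemma block_recode (n k : nat) g (x : nat -> 'I_n) m :
  block k (recode g x) m = g (mkseq x (m * k)) (block k x m).
Proof.
apply: eq_from_tnth => i; rewrite tnth_mktuple /recode.
rewrite divnMDl ?(leq_ltn_trans _ (ltn_ord i)) // divn_small // addn0.
by rewrite modnMDl modn_small // -tnth_nth.
Qed.

Lemma eq_recode (n k : nat) g (x y : nat -> 'I_n) m : 0 < k ->
  (forall i, i < m * k -> x i = y i) ->
  mkseq (recode (k := k) g x) (m * k) = mkseq (recode g y) (m * k).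
Proof.
move=> k0 xy; apply: eq_mkseq => i im.
have im' : i %/ k < m by rewrite ltn_divLR.
rewrite /recode (@eq_mkseq _ x y) => [|j ji]; last first.
  by apply: xy; apply: leq_trans ji _; rewrite leq_mul2r (ltnW im') orbT.
rewrite (@eq_block _ _ _ x y) => // j ji.
by apply: xy; apply: leq_trans ji _; rewrite leq_mul2r im' orbT.
Qed.

Lemma localizes_shrink (n k L : nat) (D : set (nat -> 'I_n)) : 0 < n -> 0 < k ->
  2 ^ k <= L.+1 -> solvable k (@localizes n k L.+1) D ->
  solvable k (@localizes n k L) D.
Proof.
move=> n0 k0 kL /solvable_bind; apply => S.
have [g gP] := surjections (k.-tuple 'I_n) [tuple (ord0 : 'I_2) | i < k].
pose gS s := g (S s); apply: (@solvable_ask _ _ _ _ _ (recode gS)) => q.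
have /choice[w wP] := fun s => excluded_block k q s (isT : 1 < 2).
pose d := Ordinal n0.
(* The recoded history is recovered from [s] alone: for a length divisible by [k], the padding [d]
   past the end of [s] is never read. *)
pose h s := mkseq (recode gS (nth d s)) (size s).
pose S' s := S s :\: [set b | gS s b == w (h s)].
apply: (@solvable_done _ _ _ _ _ S') => x [[_ [SL [N NS]]]].
move=> /weakly_const_predictsP[M MW]; split=> [s|].
  (* If [S s] has more than [L] elements, it has at least 2^k, so [gS s] is onto and some candidate
     is mapped to the excluded block. *)
  have [|sL] := leqP #|S s| L.
    exact: leq_trans (subset_leq_card (subsetDl _ _)).
  have [|t tS gt] := gP (S s) _ (w (h s)).
    by rewrite card_tuple card_ord (leq_trans kL).
  rewrite -ltnS; apply: leq_trans (SL s); apply: proper_card.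
  apply/properP; split; first exact: subsetDl.
  by exists t => //; rewrite !inE /gS gt eqxx.
exists (maxn N M) => m; rewrite geq_max => /andP[Nm Mm].
rewrite !inE NS // andbT; apply/eqP => ew.
have [i [ik]] := MW _ Mm; apply: (wP (h (mkseq x (m * k)))) => //; last first.
  by rewrite block_recode.
rewrite /h size_mkseq; apply: eq_recode => // j jm.
by rewrite nth_mkseq.
Qed.

Lemma localizes_solvable (n k : nat) : 0 < n -> 0 < k ->
  solvable k (@localizes n k (2 ^ k).-1) setT.
Proof.
(* [L] is the excess over 2^k - 1. Allowing all blocks gives a start, and each round lowers the
   excess by one. *)
move=> n0 k0; suff H L : solvable k (@localizes n k ((2 ^ k).-1 + L)) setT ->
    solvable k (@localizes n k (2 ^ k).-1) setT.
  apply: (H #|{: k.-tuple 'I_n}|).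
  apply: (@solvable_done _ _ _ _ _ (fun=> [set: k.-tuple 'I_n]%SET)) => x _.
  split=> [s|]; first by rewrite cardsT leq_addl.
  by exists 0 => m _; rewrite inE.
elim: L => [|L IH]; first by rewrite addn0.
rewrite addnS => s; apply/IH/localizes_shrink => //.
by rewrite -addSn prednK ?expn_gt0 // leq_addr.
Qed.

(** * Majority guesses *)

Section Majority.
Variables (n k : nat) (n0 : 0 < n) (S : seq 'I_n -> {set k.-tuple 'I_n}).
Let d := Ordinal n0.

Definition candidates (x : nat -> 'I_n) (m i : nat) : {set k.-tuple 'I_n} :=
  [set b in S (mkseq x (m * k)) |
    [forall j : 'I_k, (j < i) ==> (tnth b j == x (m * k + j))]].

Definition majority (x : nat -> 'I_n) (m i : nat) : 'I_n :=
  [arg max_(a > d) #|[set b in candidates x m i | nth d b i == a]|]%N.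

Definition majority_predictor : predictor n := fun s =>
  majority (nth d s) (size s %/ k) (size s %% k).

(** [candidates x m i] inspects [x] only before position [m * k + i], so padding the history with
    [d] changes nothing. *)
Lemma majority_predictorE x m i : i < k ->
  majority_predictor (mkseq x (m * k + i)) = majority x m i.
Proof.
move=> ik; rewrite /majority_predictor size_mkseq.
rewrite divnMDl ?(leq_ltn_trans _ ik) //.
rewrite divn_small // addn0 modnMDl modn_small //.
rewrite /majority (_ : candidates _ m i = candidates x m i) //.
apply/setP => b; rewrite !inE; congr (_ && _).
  congr (_ \in S _); apply: eq_mkseq => j jm.
  by rewrite nth_mkseq // (leq_trans jm) // leq_addr.
apply: eq_forallb => j; apply: implyb_id2l => ji.
by rewrite nth_mkseq // ltn_add2l.
Qed.

(* At least as many candidates agree with the majority value as with any other,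
   so a wrong guess leaves at most half of them. *)
Lemma candidates_halve x m i : i < k -> x (m * k + i) != majority x m i ->
  2 * #|candidates x m i.+1| <= #|candidates x m i|.
Proof.
move=> ik; rewrite /majority; case: arg_maxnP => // a _ amax xa.
pose C c := [set b in candidates x m i | nth d b i == c].
have CE : candidates x m i.+1 = C (x (m * k + i)).
  apply/setP => b; rewrite !inE -andbA; congr (_ && _).
  apply/forallP/andP => [H|[/forallP H /eqP bi] j].
    split; last by have := H (Ordinal ik); rewrite /= ltnSn (tnth_nth d).
    apply/forallP => j; apply/implyP => ji.
    by apply: (implyP (H j)); apply: ltnW.
  apply/implyP; rewrite ltnS leq_eqVlt => /predU1P[ji|]; last exact/implyP.
  by rewrite (tnth_nth d) ji bi.
rewrite CE mul2n -addnn (leq_trans (leq_add (leqnn _) (amax _ isT))) //.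
rewrite -cardsUI (_ : _ :&: _ = finset.set0) ?cards0 ?addn0.
  by apply/subset_leq_card/fintype.subsetP => b; rewrite !inE => /orP[]/andP[].
apply/setP => b; rewrite !inE; apply/negP => /andP[/andP[_ /eqP ->]].
by rewrite (negbTE xa) andbF.
Qed.

Lemma candidates_wrong x m i : i <= k ->
  (forall j, j < i -> x (m * k + j) != majority x m j) ->
  2 ^ i * #|candidates x m i| <= #|S (mkseq x (m * k))|.
Proof.
elim: i => [_ _|i IH ik wrong].
  rewrite mul1n; apply/subset_leq_card/fintype.subsetP => b.
  by rewrite inE => /andP[].
have := IH (ltnW ik) (fun j ji => wrong j (ltnW ji)); apply: leq_trans.
by rewrite expnSr -mulnA leq_mul2l candidates_halve ?orbT ?wrong.
Qed.

Lemma majority_hits x m : #|S (mkseq x (m * k))| < 2 ^ k ->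
  block k x m \in S (mkseq x (m * k)) ->
  exists i, i < k /\ predicts_at majority_predictor x (m * k + i).
Proof.
move=> Ssmall bS; apply: contrapT => nohit.
(* After [k] wrong guesses fewer than one candidate could remain, yet the true block always does. *)
have := @candidates_wrong x m k (leqnn k); rewrite leqNgt => /(_ _)/negP; apply.
  move=> j jk; apply/eqP => e; apply: nohit; exists j; split=> //.
  by rewrite /predicts_at majority_predictorE.
apply: leq_trans Ssmall _; rewrite leq_pmulr // card_gt0; apply/set0Pn.
exists (block k x m); rewrite inE bS; apply/forallP => j.
by rewrite tnth_mktuple eqxx implybT.
Qed.

End Majority.

Lemma weakly_solvable (n k : nat) : 0 < n -> 0 < k ->
  solvable k (fun x (pi : predictor n) => weakly_const_predicts k pi x) setT.
Proof.
move=> n0 k0; apply: (@solvable_ext _ _ _ _ _ _ _ (@majority_predictor n k n0)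
  _ (localizes_solvable n0 k0)).
move=> x S _ [SL [N NS]]; apply/weakly_const_predictsP; exists N => m Nm.
apply: majority_hits (NS _ Nm).
by rewrite (leq_ltn_trans (SL _)) // prednK ?expn_gt0.
Qed.

(** * From weak to constant prediction *)

Definition shift (T : Type) (j : nat) (x : nat -> T) (i : nat) : T := x (j + i).

Lemma solvable_comap (k : nat) (X Y P : Type) (R : X -> P -> Prop) (D : set X)
    (h : Y -> X) : solvable k R D -> solvable k (fun y => R (h y)) (h @^-1` D).
Proof.
elim=> {D} [D p DR|D f _ IH].
  by apply: (@solvable_done _ _ _ _ _ p) => y /DR.
by apply: (@solvable_ask _ _ _ _ _ (f \o h)) => q; apply: (IH q).
Qed.

Lemma shifts_solvable (n k J : nat) : 0 < n -> 0 < k ->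
  solvable k (fun x (p : nat -> predictor n) =>
    forall j, j < J -> weakly_const_predicts k (p j) (shift j x)) setT.
Proof.
move=> n0 k0; elim: J => [|J IH].
  by apply: (@solvable_done _ _ _ _ _ (fun _ _ => Ordinal n0)).
apply: (solvable_bind IH) => p.
apply: (@solvable_ext _ _ _ _ _ _ _
  (fun q j => if j == J then q else p j) _
  (solvable_sub _ (solvable_comap (shift J) (weakly_solvable n0 k0)))) => //.
move=> x q [_ /= px] qx j; rewrite ltnS leq_eqVlt.
by case: eqVneq => [-> _|_ /px].
Qed.

Section Combine.
Variables (n k : nat) (n0 : 0 < n) (k0 : 0 < k) (p : nat -> predictor n).
Let d := Ordinal n0.

(** [start] and [combined] call it only with [r <= i], where the truncated subtraction is exact. *)
Definition guess (x : nat -> 'I_n) (r i : nat) : 'I_n :=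
  p (r %% k) (mkseq (shift (r %% k) x) (i - r %% k)).

(* The position following the last correct guess before i.  The predictor used
   from position r on is the one whose blocks start at positions congruent to r
   modulo k, so it is right again before r + k, once r is large. *)
Fixpoint start (x : nat -> 'I_n) (i : nat) : nat :=
  if i is j.+1 then
    if x j == guess x (start x j) j then j.+1 else start x j
  else 0.

Definition combined : predictor n := fun s =>
  guess (nth d s) (start (nth d s) (size s)) (size s).

Lemma eq_guess x y r i : (forall l, l < i -> x l = y l) ->
  guess x r i = guess y r i.
Proof.
move=> xy; congr (p _ _); apply: eq_mkseq => l li; apply: xy.
by rewrite -ltn_subRL.
Qed.

Lemma eq_start x y i : (forall l, l < i -> x l = y l) -> start x i = start y i.
Proof.
elim: i => //= i IH xy; have xy' l : l < i -> x l = y l by move=> /ltnW /xy.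
by rewrite IH // (@eq_guess x y) // xy.
Qed.

Lemma combinedE x i : combined (mkseq x i) = guess x (start x i) i.
Proof.
have agree l : l < i -> nth d (mkseq x i) l = x l by apply: nth_mkseq.
by rewrite /combined size_mkseq (eq_guess _ agree) (eq_start agree).
Qed.

Lemma start_le x i : start x i <= i.
Proof. by elim: i => //= i IH; case: ifP => // _; apply: leqW. Qed.

Lemma start_wrong x i l : start x i <= l < i -> x l != guess x (start x i) l.
Proof.
elim: i => [|i IH] /=; first by rewrite ltn0.
case: ifPn => [_ /andP[il]|wrong /andP[rl]]; first by rewrite ltnS leqNgt il.
rewrite ltnS leq_eqVlt => /predU1P[->//|li].
by apply: IH; rewrite rl.
Qed.

Lemma combined_predicts x :
  (forall j, j < k -> weakly_const_predicts k (p j) (shift j x)) ->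
  const_predicts k combined x.
Proof.
move=> px; have /choice[M MP] : forall j, exists M, forall m, j < k -> M <= m ->
    exists i, i < k /\ predicts_at (p j) (shift j x) (m * k + i).
  move=> j; have [jk|kj] := ltnP j k; last by exists 0.
  by have /weakly_const_predictsP[M MP] := px _ jk; exists M => m _; apply: MP.
pose M1 := \max_(j < k) M j.
apply/const_predictsP; exists (M1 * k + k) => a aM; apply: contrapT => nohit.
(* Without a correct guess from [a] on, [start] does not move past [a]. *)
have stuck i : i <= k -> start x (a + i) <= a.
  elim: i => [|i IH] ik; first by rewrite addn0 start_le.
  rewrite addnS /=; case: eqP => [e|_]; last exact: IH (ltnW ik).
  case: nohit; exists (a + i); rewrite leq_addr ltn_add2l ik; split=> //.
  by rewrite /predicts_at combinedE.
have ra := stuck k (leqnn k); set r := start x (a + k) in ra.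
have jk : r %% k < k by rewrite ltn_pmod.
(* Block [m] of the predictor in use begins at [r] if [M1 <= r %/ k], and otherwise before
   [M1 * k + k]. Either way it lies between [r] and [a + k], where every guess was wrong, although
   [M1] promises a hit. *)
pose m := maxn (r %/ k) M1.
have [|i [ik hit]] := MP (r %% k) m jk.
  have := leq_bigmax (F := fun j : 'I_k => M j) (Ordinal jk).
  by move/leq_trans; apply; apply: leq_maxr.
have rm : r <= r %% k + m * k.
  by rewrite {1}(divn_eq r k) addnC leq_add2l leq_mul2r leq_maxl orbT.
have ma : r %% k + m * k <= a.
  rewrite /m; case: (leqP (r %/ k) M1) => _; last by rewrite addnC -divn_eq.
  by apply: leq_trans aM; rewrite addnC leq_add2l ltnW.
have := @start_wrong x (a + k) (r %% k + (m * k + i)); rewrite -/r addnA.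
rewrite (leq_trans rm (leq_addr _ _)) /= -addnS leq_add // => /(_ isT)/eqP; apply.
by rewrite /guess -addnA addKn; exact: hit.
Qed.

End Combine.

Lemma const_solvable (n k : nat) : 0 < n -> 0 < k ->
  solvable k (fun x (pi : predictor n) => const_predicts k pi x) setT.
Proof.
move=> n0 k0.
apply: (@solvable_ext _ _ _ _ _ _ _ (combined k n0) _
  (@shifts_solvable n k k n0 k0)).
by move=> x p _; apply: combined_predicts.
Qed.

(** Guesses of 2 or more become 0; they are never right on a binary sequence, so no hit is lost. *)
Definition binary_predictor (n : nat) (n1 : 1 < n) (pi : predictor n) :
    predictor 2 :=
  fun s => insubd ord0 (val (pi (map (widen_ord n1) s))).

Lemma binary_predictor_weakly (n k : nat) (n1 : 1 < n) (pi : predictor n) x :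
  weakly_const_predicts k pi (widen_ord n1 \o x) ->
  weakly_const_predicts k (binary_predictor n1 pi) x.
Proof.
move=> /weakly_const_predictsP[N pix]; apply/weakly_const_predictsP.
exists N => m /pix[i [ik pii]]; exists i; split=> //.
rewrite /predicts_at /binary_predictor.
have -> : map (widen_ord n1) (mkseq x (m * k + i)) =
    mkseq (widen_ord n1 \o x) (m * k + i) by rewrite /mkseq -map_comp.
by rewrite -pii; apply/val_inj; rewrite insubdK ?unfold_in /=.
Qed.

(** * Comparison of the cardinals *)

Section Cardinals.
Variables (n k : nat) (n1 : 1 < n) (k0 : 0 < k).
Let n0 : 0 < n := ltnW n1.

Lemma vbar_le_v : vbar_const n k #<= v_const n k.
Proof.
have [_] := least_sizeP (vbar_family_neq0 n k0); apply.
move=> x; have [/(_ x) [pi [Ppi pix]] _] := least_sizeP (v_family_neq0 n k0).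
by exists pi; split=> //; apply: const_predicts_weakly.
Qed.

Lemma vbar2_le_vbar : vbar_const 2 k #<= vbar_const n k.
Proof.
apply: card_le_trans (card_image_le (binary_predictor n1) _).
have [_] := least_sizeP (vbar_family_neq0 2 k0); apply => x.
have [/(_ (widen_ord n1 \o x))[pi [Ppi pix]] _] :=
  least_sizeP (vbar_family_neq0 n k0).
exists (binary_predictor n1 pi); split; first by exists pi.
exact: binary_predictor_weakly pix.
Qed.

(** Finite families never suffice, so [vbar_const 2 k] is infinite and answering all queries from it
    costs no cardinality. *)
Lemma v_le_vbar2 : v_const n k #<= vbar_const 2 k.
Proof.
have [vbarP _] := least_sizeP (vbar_family_neq0 2 k0).
have infv : infinite_set (vbar_const 2 k).
  move=> /(@finite_not_weakly_predicting 2 k _ isT)[x xP].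
  by have [pi [Ppi]] := vbarP x; apply: xP.
have [C Cv CP] := solvable_cover infv vbarP (const_solvable n0 k0).
apply: card_le_trans Cv.
have [_] := least_sizeP (v_family_neq0 n k0); apply => x.
by have [pi Cpi pix] := CP x I; exists pi.
Qed.

Lemma e_le_ebar : e_const n k #<= ebar_const n k.
Proof.
have [_] := least_sizeP (@e_family_neq0 n k n1); apply => pi.
have [ebarP _] := least_sizeP (@ebar_family_neq0 n k n1).
apply: contrapT => nopi; apply: ebarP; exists pi => x Fx.
apply: const_predicts_weakly => //; apply: contrapT => npi.
by apply: nopi; exists x.
Qed.

Lemma ebar_le_ebar2 : ebar_const n k #<= ebar_const 2 k.
Proof.
apply: card_le_trans (card_image_le (fun x => widen_ord n1 \o x) _).
have [_] := least_sizeP (@ebar_family_neq0 n k n1); apply => -[pi piP].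
have [ebarP _] := least_sizeP (@ebar_family_neq0 2 k isT).
apply: ebarP; exists (binary_predictor n1 pi) => x Fx.
by apply: binary_predictor_weakly; apply: piP; exists x.
Qed.

Lemma ebar2_le_e : ebar_const 2 k #<= e_const n k.
Proof.
have [eP _] := least_sizeP (@e_family_neq0 n k n1).
have [_ ebarle] := least_sizeP (@ebar_family_neq0 2 k isT).
(* If the inequality fails, every binary family no larger than [e_const n k] is weakly predicted by
   one predictor, and then so is [e_const n k] constantly. *)
apply: contrapT => nle.
suff uni (G : set (nat -> 'I_2)) : G #<= e_const n k ->
    exists q, forall y, G y -> weakly_const_predicts k q y.
  have [pi piP] := solvable_uniform uni (@subsetT _ _) (const_solvable n0 k0).
  by have [x [/piP]] := eP pi.
move=> Gle; apply: contrapT => noq; apply: nle.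
exact: card_le_trans (ebarle _ noq) Gle.
Qed.

End Cardinals.

Theorem theorem1p3 (n k : nat) (hn : 2 <= n) (hk : 1 <= k) :
  (vbar_const n k #= v_const n k /\ v_const n k #= v_const 2 k) /\
  (ebar_const n k #= e_const n k /\ e_const n k #= e_const 2 k).
Proof.
(* These close the cycles v_n <= vbar_2 <= vbar_n <= v_n and e_n <= ebar_n <= ebar_2 <= e_n; the
   instances at 2 bring in v_2 and e_2. *)
have vv2 := v_le_vbar2 hn hk; have ee2 := ebar2_le_e hn hk.
split; split; rewrite card_eq_le; apply/andP; split.
- exact: vbar_le_v.
- exact: card_le_trans vv2 (vbar2_le_vbar hn hk).
- exact: card_le_trans vv2 (@vbar_le_v 2 k hk).
- apply: card_le_trans (@v_le_vbar2 2 k isT hk) _.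
  exact: card_le_trans (vbar2_le_vbar hn hk) (vbar_le_v n hk).
- exact: card_le_trans (ebar_le_ebar2 k hn) ee2.
- exact: e_le_ebar.
- apply: card_le_trans (e_le_ebar hn hk) _.
  exact: card_le_trans (ebar_le_ebar2 k hn) (@ebar2_le_e 2 k isT hk).
- exact: card_le_trans (@e_le_ebar 2 k isT hk) ee2.
Qed.
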